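(* Let $X$ be a deterministic dynamical system in $\mathsf{Stoch}$ with monoid $M$. Then the Markov quotient $X_{\mathrm{inv}}$ exists, and it is given by the same set $X$ equipped with the invariant $\sigma$-algebra (with quotient map $r:X\to X_{\mathrm{inv}}$ the kernel induced by the set-theoretic identity).
   Context: $\mathsf{Stoch}$ is the category whose objects are measurable spaces and whose morphisms $X\to Y$ are Markov kernels $k(B|x)$ (a probability measure in $B\in\Sigma_Y$ for each $x\in X$, and measurable in $x$ for each $B$), with composition $(h\circ k)(C|x)=\int_Y h(C|y)\,k(dy|x)$. A kernel $f:X\to Y$ is deterministic if $f(B|x)\in\{0,1\}$ for all $x\in X$, $B\in\Sigma_Y$; $\mathsf{Stoch}_{\det}$ is the subcategory of deterministic kernels. A measurable function $f$ induces the deterministic kernel $(B|x)\mapsto 1$ if $f(x)\in B$ and $0$ otherwise. A dynamical system in $\mathsf{Stoch}$ with monoid $M$ is a measurable space $X$ together with a monoid homomorphism from $M$ to the monoid of Markov kernels $X\to X$; the kernel induced by $m\in M$ is again written $m$. It is deterministic if every $m:X\to X$ is a deterministic kernel. A measurable set $A\in\Sigma_X$ is invariant if $m(A|x)=1_A(x)$ for every $m\in M$ and $x\in X$. The invariant sets form a $\sigma$-algebra, called the invariant $\sigma$-algebra. A kernel $s:X\to S$ is (right-)invariant if $s\circ m=s$ for all $m\in M$. A Markov quotient (Markov colimit) of $X$ is an object $X_{\mathrm{inv}}$ with a deterministic invariant morphism $r:X\to X_{\mathrm{inv}}$ which is a colimit of the dynamical system both in $\mathsf{Stoch}$ and in $\mathsf{Stoch}_{\det}$: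 for every invariant $s:X\to S$ there is a unique kernel $\tilde s:X_{\mathrm{inv}}\to S$ with $s=\tilde s\circ r$, and $\tilde s$ is deterministic if and only if $s$ is. *)

(* Defs.v *)
From HB Require Import structures.
From mathcomp Require Import all_boot all_order all_algebra.
From mathcomp Require Import all_classical all_reals all_analysis.

Set Implicit Arguments.
Unset Strict Implicit.
Unset Printing Implicit Defensive.
Import Order.TTheory GRing.Theory Num.Theory.

Local Open Scope classical_set_scope.
Local Open Scope ring_scope.
Local Open Scope ereal_scope.

(* Objects of Stoch are measurableType's, which the library takes pointed, hence
   nonempty. Only the empty dynamical system is lost; there is no Markov kernel
   from a nonempty space to the empty one, so targets are unaffected. *)

Section stoch.
Context {R : realType}.

(* A library measure is a function on all subsets, constrained only on the
   measurable ones, so Leibniz equality of kernels is too fine: two kernels are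
   the same morphism of Stoch when they agree on measurable sets. *)
Definition stoch_eq d d' (X : measurableType d) (Y : measurableType d')
    (f g : R.-pker X ~> Y) : Prop :=
  forall x B, measurable B -> f x B = g x B.

Definition stoch_id d (X : measurableType d) : R.-pker X ~> X :=
  kdirac (@measurable_id _ X setT).

Section comp.
Context d d' d'' (X : measurableType d) (Y : measurableType d')
  (Z : measurableType d'').
Variables (h : R.-pker Y ~> Z) (k : R.-pker X ~> Y).

Let mkcomp_noparam_prob x : mkcomp_noparam k h x [set: Z] = 1.
Proof.
rewrite /mkcomp_noparam /= /kcomp_noparam.
under eq_integral do rewrite prob_kernel.
by rewrite integral_cst// mul1e prob_kernel.
Qed.

HB.instance Definition _ := @isProbabilityKernel.Build _ _ _ _ R
  (mkcomp_noparam k h) mkcomp_noparam_prob.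

Definition stoch_comp : R.-pker X ~> Z := mkcomp_noparam k h.

(* (h o k)(C|x) = \int_Y h(C|y) k(dy|x) *)
Lemma stoch_compE x C : stoch_comp x C = \int[k x]_y h y C.
Proof. by []. Qed.

End comp.

Definition deterministic d d' (X : measurableType d) (Y : measurableType d')
    (f : R.-pker X ~> Y) : Prop :=
  forall x B, measurable B -> f x B = 0 \/ f x B = 1.

End stoch.

Arguments stoch_id {R d} X.

Notation "f =k g" := (stoch_eq f g) (at level 70, no associativity).
Notation "h \ok k" := (stoch_comp h k) (at level 50, left associativity).

Record dynamical_system (R : realType) (M : monoidType) d
    (X : measurableType d) := DynamicalSystem {
  act :> M -> R.-pker X ~> X;
  act1 : act 1%g =k stoch_id X;
  actM : forall m n, act (m * n)%g =k act m \ok act n }.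

Section dynamical_system.
Context {R : realType} {M : monoidType} {d} {X : measurableType d}.
Variable phi : dynamical_system R M X.

Definition deterministic_system : Prop := forall m, deterministic (phi m).

Definition invariant_set (A : set X) : Prop :=
  measurable A /\ forall m x, phi m x A = (\1_A x)%:E.

Definition invariant_kernel d' (S : measurableType d') (s : R.-pker X ~> S) :
    Prop :=
  forall m, s \ok phi m =k s.

Record is_markov_quotient d' (Q : measurableType d') (r : R.-pker X ~> Q) :
    Prop := IsMarkovQuotient {
  markov_quotient_deterministic : deterministic r;
  markov_quotient_invariant : invariant_kernel r;
  markov_quotient_universal : forall dS (S : measurableType dS)
      (s : R.-pker X ~> S), invariant_kernel s ->
    exists t : R.-pker Q ~> S,
      [/\ s =k t \ok r,
          forall t' : R.-pker Q ~> S, s =k t' \ok r -> t' =k t &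
          deterministic t <-> deterministic s] }.

Lemma invariant_set0 : invariant_set set0.
Proof. by split=> // m x; rewrite measure0 indic0. Qed.

Lemma invariant_setC A : invariant_set A -> invariant_set (~` A).
Proof.
move=> [mA iA]; split=> [|m x]; first exact: measurableC.
have finA : phi m x A \is a fin_num by rewrite iA.
have : phi m x setT = phi m x A + phi m x (~` A).
  by rewrite -measureU// ?setICr ?setUCr//; exact: measurableC.
rewrite prob_kernel iA => e1.
have -> : phi m x (~` A) = 1 - (\1_A x)%:E by rewrite e1 addeAC subee// add0e.
by rewrite !indicE in_setC; case: (x \in A); rewrite -EFinB /= ?subrr ?subr0.
Qed.

Lemma invariant_bigcup (F : (set X)^nat) :
  (forall i, invariant_set (F i)) -> invariant_set (\bigcup_i F i).
Proof.
move=> iF; have mF i : measurable (F i) by case: (iF i).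
have mU : measurable (\bigcup_i F i) by exact: bigcup_measurable.
split=> // m x; rewrite indicE; have [|] := boolP (x \in \bigcup_i F i).
  rewrite inE => -[i _ Fix].
  apply/eqP; rewrite eq_le; apply/andP; split.
    rewrite -[leRHS](prob_kernel (s := phi m) x).
    by apply: le_measure; rewrite ?inE.
  rewrite (_ : 1%:R%:E = phi m x (F i)); last first.
    by case: (iF i) => _ ->; rewrite indicE mem_set.
  by apply: le_measure; rewrite ?inE//; exact: bigcup_sup.
rewrite notin_setE => nUx; apply/eqP; rewrite eq_le measure_ge0 andbT.
rewrite (le_trans (measure_sigma_subadditive (phi m x) mF mU (@subset_refl _ _)))//.
rewrite eseries0// => i _ _; case: (iF i) => _ ->.
by rewrite indicE memNset// => Fix; apply: nUx; exists i.
Qed.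

End dynamical_system.

(* Same underlying set as X; phi only serves to select the sigma-algebra. *)
Definition inv_space (R : realType) (M : monoidType) d (X : measurableType d)
    (phi : dynamical_system R M X) : Type := X.

Definition inv_display (R : realType) (M : monoidType) d
  (X : measurableType d) : dynamical_system R M X -> measure_display.
Proof. by move=> _; exact: d. Qed.

Section inv_space.
Context {R : realType} {M : monoidType} {d} {X : measurableType d}.
Variable phi : dynamical_system R M X.

HB.instance Definition _ := Pointed.copy (inv_space phi) X.
HB.instance Definition _ := @isMeasurable.Build (inv_display phi)
  (inv_space phi) (invariant_set phi) (invariant_set0 phi)
  (@invariant_setC _ _ _ _ phi) (@invariant_bigcup _ _ _ _ phi).

Lemma measurable_to_inv_space :
  measurable_fun [set: X] (fun x : X => x : inv_space phi).
Proof. by move=> _ A [mA _]; rewrite setTI. Qed.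

Definition inv_quotient : R.-pker X ~> inv_space phi :=
  kdirac measurable_to_inv_space.

End inv_space.

(* Main.v *)
Require Import Defs.
From HB Require Import structures.
From mathcomp Require Import all_boot all_order all_algebra.
From mathcomp Require Import all_classical all_reals all_analysis.
From mathcomp Require Import measurable_realfun.

(** Composing a kernel [t] out of [inv_space phi] with [inv_quotient phi] gives
    back [t] pointwise ([stoch_comp_inv_quotient]), because the quotient kernel
    at [x] is the Dirac measure at [x]. A factorization of [s] is thus forced to
    be [s] itself, and is deterministic exactly when [s] is. All the content of
    the statement is that [s], when invariant, is still a kernel over the smaller
    sigma-algebra: for every measurable [B], the function [x |-> s x B] must be
    measurable for the invariant sets.

    Fix [B] and write [g x = s x B]. Invariance of [s] says that the integral of
    [g] against [phi m x] is [g x], and determinism says that [phi m x] takes only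
    the values 0 and 1. An integrable function is almost everywhere equal to its
    mean under such a probability ([zero_one_ae_eq_integral]): the sign of its
    deviation from the mean is almost surely constant, so the mean absolute
    deviation is, up to sign, the mean deviation, which is zero. Hence [phi m x]
    gives [g @^-1` U] mass 1 or 0 according to whether [g x] lies in [U], i.e.
    whether [x] lies in [g @^-1` U]. This is the invariance of [g @^-1` U]
    ([invariant_kernel_preimage]). *)

Set Implicit Arguments.
Unset Strict Implicit.
Unset Printing Implicit Defensive.
Import Order.TTheory GRing.Theory Num.Theory.

Local Open Scope classical_set_scope.
Local Open Scope ring_scope.
Local Open Scope ereal_scope.

Lemma probability_integral_cst d (T : measurableType d) (R : realType)
    (P : probability T R) (c : \bar R) : \int[P]_x c = c.
Proof. by rewrite (integral_cst P measurableT) /= probability_setT mule1. Qed.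

Section zero_one_measure.
Context d (T : measurableType d) (R : realType).
Variable P : probability T R.
Hypothesis P01 : forall A, measurable A -> P A = 0 \/ P A = 1.

Lemma zero_one_ae A : measurable A ->
  {ae P, forall x, A x} \/ {ae P, forall x, ~ A x}.
Proof.
move=> mA; have [PA|PA] := P01 mA; [right|left].
- by exists A; split=> // x /= /contrapT.
- exists (~` A); split; [exact: measurableC| |by []].
  by rewrite probability_setC// PA subee.
Qed.

(** With [h] the deviation of [g] from its mean, the event [0 <= h] is almost sure
    or almost impossible. So [`|h|] is almost everywhere [h], or almost everywhere
    [- h]; in both cases it has integral 0, and [h] vanishes almost everywhere. *)
Lemma zero_one_ae_eq_integral (g : T -> \bar R) : P.-integrable setT g ->
  ae_eq P setT g (cst (\int[P]_x g x)).
Proof.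
move=> ig; have /fineK cE := integrable_fin_num measurableT ig.
set c := fine _ in cE; rewrite -cE.
pose h x : \bar R := g x - c%:E.
have ic : P.-integrable setT (EFin \o cst c).
  exact: finite_measure_integrable_cst.
have ih : P.-integrable setT h := integrableB measurableT ig ic.
have mh : measurable_fun setT h := measurable_int _ ih.
have h0 : \int[P]_x h x = 0.
  rewrite /h (integralB measurableT ig ic) -cE.
  by rewrite [X in _ - X](probability_integral_cst P c%:E) subee.
have [mN mA]: measurable_fun setT (fun x => - h x) /\
    measurable_fun setT (fun x => `|h x|).
  by split; exact: measurableT_comp.
have : \int[P]_x `|h x| = 0.
  have [hP|hP] : {ae P, forall x, 0 <= h x} \/ {ae P, forall x, ~ 0 <= h x}.
    have := zero_one_ae (mh measurableT _ (emeasurable_itv `[0, +oo[)).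
    by rewrite setTI => -[] H; [left|right]; move: H; apply: filterS => x /=;
      rewrite in_itv/= andbT.
  - rewrite -h0; apply: ae_eq_integral => //.
    by move: hP; apply: filterS => x hx _; rewrite gee0_abs.
  - rewrite (@ae_eq_integral _ _ _ P setT (fun x => - h x))//.
      by rewrite (integralN (integrable_add_def measurableT ih)) h0 oppe0.
    move: hP; apply: filterS => x hx _; rewrite lee0_abs//.
    by apply: ltW; rewrite ltNge; apply/negP.
move=> /(ae_eq_integral_abs P measurableT mh).
apply: filterS => x /(_ I); rewrite /h /=.
by case: (g x) => [r| |]// [/subr0_eq ->].
Qed.

Lemma zero_one_preimage (g : T -> \bar R) (U : set (\bar R)) :
  P.-integrable setT g -> measurable U ->
  P (g @^-1` U) = (\1_U (\int[P]_x g x)%E)%:E.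
Proof.
move=> ig mU.
have mgU : measurable (g @^-1` U).
  by rewrite -[_ @^-1` _]setTI; exact: (measurable_int _ ig measurableT _ mU).
have gc := zero_one_ae_eq_integral ig.
rewrite -(setIT (_ @^-1` _)) -integral_indic//.
rewrite (@ae_eq_integral _ _ _ P setT (cst (\1_U (\int[P]_x g x)%E)%:E))//.
- exact: probability_integral_cst.
- by apply/measurable_EFinP; exact: measurable_indic.
- by move: gc; apply: filterS => x /(_ I) /= <- _.
Qed.
End zero_one_measure.

(** Integrating against [k x] as a probability. The head is a bare set function
    because the probability structure has to be attached to a function, whereas
    [k x] is already a bundled measure. *)
Section kernel_at.
Context d d' (X : measurableType d) (Y : measurableType d') (R : realType).
Variables (k : R.-pker X ~> Y) (x : X).

Definition kernel_at : set Y -> \bar R := k x.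

HB.instance Definition _ := isMeasure.Build _ _ _ kernel_at
  (measure0 (k x)) (measure_ge0 (k x)) (@measure_semi_sigma_additive _ _ _ (k x)).
HB.instance Definition _ :=
  Measure_isProbability.Build _ _ R kernel_at (prob_kernel x).
End kernel_at.

Lemma kernel_integrable d d' (X : measurableType d) (S : measurableType d')
    (R : realType) (P : probability X R) (s : R.-pker X ~> S) B :
  measurable B -> P.-integrable setT (s ^~ B).
Proof.
move=> mB; apply: (@le_integrable _ _ _ _ _ measurableT _ (EFin \o cst 1%R)).
- exact: measurable_kernel.
- move=> x _ /=; rewrite normr1 gee0_abs// -[leRHS](prob_kernel (s := s) x).
  by apply: le_measure; rewrite ?inE.
- exact: finite_measure_integrable_cst.
Qed.

Section factor.
Context (R : realType) (M : monoidType) d (X : measurableType d).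
Variable phi : dynamical_system R M X.

(** The invariance equation for [s] says that the mean of [s ^~ B] under [phi m x]
    is its value at [x]; [zero_one_preimage] then evaluates [phi m x] on the
    preimage. *)
Lemma invariant_kernel_preimage d' (S : measurableType d') (s : R.-pker X ~> S)
    (B : set S) (U : set (\bar R)) :
  deterministic_system phi -> invariant_kernel phi s ->
  measurable B -> measurable U -> invariant_set phi ((s ^~ B) @^-1` U).
Proof.
move=> phi_det s_inv mB mU; split.
  by rewrite -[_ @^-1` _]setTI; exact: measurable_kernel.
move=> m x.
have s_int := kernel_integrable (kernel_at (phi m) x) s mB.
(* The value [s x B] hidden in the indicator becomes an integral. *)
rewrite -[RHS]/((\1_U (s x B))%:E) -(s_inv m x B mB) stoch_compE.
have := @zero_one_preimage _ _ _ (kernel_at (phi m) x) (phi_det m x) _ _ s_int mU.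
exact.
Qed.

Lemma inv_quotientE x A : inv_quotient phi x A = (\1_A x)%:E.
Proof. by []. Qed.

Lemma stoch_comp_inv_quotient d' (S : measurableType d')
    (t : R.-pker (inv_space phi) ~> S) x B : measurable B ->
  (t \ok inv_quotient phi) x B = t x B.
Proof.
move=> mB; rewrite stoch_compE integral_dirac//; last exact: measurable_kernel.
by rewrite diracT mul1e.
Qed.

Section factor_kernel.
Context d' (S : measurableType d') (s : R.-pker X ~> S).
Hypothesis phi_det : deterministic_system phi.
Hypothesis s_inv : invariant_kernel phi s.

Definition factor (x : inv_space phi) : {measure set S -> \bar R} := s x.

Let measurable_factor B : measurable B ->
  measurable_fun [set: inv_space phi] (factor ^~ B).
Proof.
move=> mB _ U mU; rewrite setTI.
exact: (invariant_kernel_preimage phi_det s_inv mB mU).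
Qed.

HB.instance Definition _ := isKernel.Build _ _ _ _ _ factor measurable_factor.

Let factor_prob x : factor x [set: S] = 1.
Proof. exact: prob_kernel. Qed.

HB.instance Definition _ := Kernel_isProbability.Build _ _ _ _ _
  factor factor_prob.

Definition factor_kernel : R.-pker (inv_space phi) ~> S := factor.
End factor_kernel.
End factor.

Theorem proposition3p7 (R : realType) (M : monoidType) (d : measure_display)
    (X : measurableType d) (phi : dynamical_system R M X)
    (phi_det : deterministic_system phi) :
  is_markov_quotient phi (inv_quotient phi).
Proof.
split.
- move=> x A _; rewrite inv_quotientE indicE.
  by case: (x \in A); [right|left].
- move=> m x A [mA iA]; rewrite stoch_compE inv_quotientE -(iA m).
  under eq_integral do rewrite inv_quotientE.
  by rewrite integral_indic// setIT.
- move=> dS S s s_inv; exists (factor_kernel phi_det s_inv); split.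
  + by move=> x B mB; rewrite stoch_comp_inv_quotient.
  + by move=> t' st' x B mB; rewrite -stoch_comp_inv_quotient// -st'.
  + by [].
Qed.
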